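(* Let $H$ be a hypergraph with $m\ge 2$ hyperedges and let $S$ be a minimum locating-dominating set for $H$. For each $d\ge 1$ and each $1\le i\le \binom{m}{d}$, let $C_i^{(d)}=S\cap S_i^{(d)}$ if the coincident set $S_i^{(d)}$ is non-empty, and $C_i^{(d)}=\emptyset$ if $S_i^{(d)}=\emptyset$. Let $C=\bigcup_{d=1}^{\Delta(H)}\bigcup_{i=1}^{\binom{m}{d}} C_i^{(d)}$. Then $$|S|\ \ge\ |C|=\sum_{d=1}^{\Delta(H)}\sum_{i=1}^{\binom{m}{d}}|C_i^{(d)}|.$$
   Context: A hypergraph $H$ is a pair $(V(H),E(H))$ with $V(H)$ a finite set and $E(H)$ a finite family of non-empty subsets of $V(H)$ (hyperedges) whose union is $V(H)$. Standing assumption: all hypergraphs are connected (any two vertices are joined by a path $v,E_1,w_1,E_2,\ldots,w_{l-1},E_l,u$ with $v\in E_1$, $w_i\in E_i\cap E_{i+1}$, $u\in E_l$) and Sperner (no hyperedge is a subset of another hyperedge). The degree of a vertex is the number of hyperedges containing it; $\Delta(H)$ is the maximum degree. For a vertex $u$, $N(u)$ is the set of vertices $v\ne u$ such that some hyperedge contains both $u$ and $v$. A set $S\subseteq V(H)$ is locating-dominating if for any two distinct $u,v\in V(H)-S$, $N(u)\cap S\neq N(v)\cap S$, and $N(u)\cap S\ne\emptyset$ for every $u\in V(H)-S$; it is minimum if it has minimum cardinality among such sets. Let $E_1,\ldots,E_m$ be the hyperedges. For each $d$ let $E_1^{(d)},\ldots,E_{\binom{m}{d}}^{(d)}$ enumerate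 the $d$-element subsets of $E(H)$. The coincident set $S_i^{(d)}$ is the set of all vertices of degree $d$ that belong to every hyperedge of $E_i^{(d)}$ (possibly empty). *)

(* Defs.v *)
From mathcomp Require Import all_boot.

Set Implicit Arguments.
Unset Strict Implicit.
Unset Printing Implicit Defensive.

(* The vertex set V(H) is the whole finite type V.  Hyperedges form a set
   rather than a multiset: the Sperner condition excludes repetitions. *)
Record hypergraph (V : finType) := Hypergraph {
  edges : {set {set V}};
  edges_nonempty : set0 \notin edges;
  edges_cover : cover edges = [set: V]
}.

Section Hypergraph.

Variables (V : finType) (H : hypergraph V).

Definition share_edge : rel V :=
  fun u v => [exists e in edges H, (u \in e) && (v \in e)].

(* A path v, E_1, w_1, E_2, ..., w_(l-1), E_l, u is a sequence of vertices
   v, w_1, ..., w_(l-1), u in which consecutive vertices lie in a common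
   hyperedge, i.e. a path of the relation share_edge. *)
Definition connected_hypergraph : Prop :=
  forall u v : V, connect share_edge u v.

Definition sperner : Prop :=
  {in edges H &, forall e f : {set V}, e != f -> ~~ (e \subset f)}.

Definition degree (v : V) : nat := #|[set e in edges H | v \in e]|.

Definition max_degree : nat := \max_(v : V) degree v.

Definition neighbours (u : V) : {set V} :=
  [set v | (v != u) && share_edge u v].

Definition locating_dominating (S : {set V}) : Prop :=
  (forall u v : V, u \notin S -> v \notin S -> u != v ->
     neighbours u :&: S != neighbours v :&: S) /\
  (forall u : V, u \notin S -> neighbours u :&: S != set0).

Definition minimum_locating_dominating (S : {set V}) : Prop :=
  locating_dominating S /\
  (forall T : {set V}, locating_dominating T -> #|S| <= #|T|).

(* F d lists, without repetition, the d-element subsets of E(H): the F d i are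
   the E_i^(d), with i starting from 0. *)
Definition enumerates_edge_subsets
    (F : forall d : nat, 'I_('C(#|edges H|, d)) -> {set {set V}}) : Prop :=
  forall d : nat, injective (F d) /\
    (forall A : {set {set V}},
       (exists i, F d i = A) <-> (A \subset edges H) && (#|A| == d)).

Definition coincident (d : nat) (A : {set {set V}}) : {set V} :=
  [set v | (degree v == d) && [forall e in A, v \in e]].

Definition coincident_part (S : {set V}) (d : nat) (A : {set {set V}}) :
    {set V} :=
  if coincident d A != set0 then S :&: coincident d A else set0.

End Hypergraph.

(* Main.v *)
Require Import Defs.
From mathcomp Require Import all_boot.

Set Implicit Arguments.
Unset Strict Implicit.
Unset Printing Implicit Defensive.

(** The coincident sets partition the vertices: a vertex [v] of degree [d] lies
    in the coincident set of a [d]-element family [A] of hyperedges only when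
    every member of [A] contains [v], and since exactly [d] hyperedges contain
    [v], the family [A] must be the set of all of them ([coincident_star]).
    So [v] determines both [d] and [A], and as the enumeration is injective it
    determines the pair of indices.  The parts of [C] are therefore pairwise
    disjoint subsets of [S], which gives the sum formula for [#|C|]
    ([card_bigcup_disjoint], once over the families of a given size and once
    over the sizes) as well as the bound [#|C| <= #|S|]. *)

Lemma mem_bigcup_seq (I : eqType) (T : finType) (r : seq I)
    (F : I -> {set T}) (x : T) :
  x \in \bigcup_(i <- r) F i -> exists2 i, i \in r & x \in F i.
Proof.
rewrite big_seq; elim/big_rec: _ => [|i A ri IHA]; first by rewrite inE.
by case/setUP=> [Fix | /IHA//]; exists i.
Qed.

(** The index ranges over a duplicate-free sequence, so that the same lemma
    applies to an interval of [nat] and to an ordinal type. *)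
Lemma card_bigcup_disjoint (I : eqType) (T : finType) (r : seq I)
    (F : I -> {set T}) :
  uniq r ->
  {in r &, forall i j x, x \in F i -> x \in F j -> i = j} ->
  #|\bigcup_(i <- r) F i| = \sum_(i <- r) #|F i|.
Proof.
elim: r => [|i r IHr] /= => [_ _|/andP[i_notin_r uniq_r] F_inj].
  by rewrite !big_nil cards0.
rewrite !big_cons -IHr // => [|j k rj rk]; last first.
  by apply: F_inj; rewrite in_cons ?rj ?rk orbT.
apply/eqP; rewrite (leq_card_setU _ _).2 disjoint_subset.
apply/subsetP=> x Fix; apply/negP=> /mem_bigcup_seq[j rj Fjx].
have eq_ij : i = j by apply: F_inj Fix Fjx; rewrite in_cons ?eqxx ?rj ?orbT.
by rewrite eq_ij rj in i_notin_r.
Qed.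

Section CoincidentSets.

Variables (V : finType) (H : hypergraph V).

(** Every member of [A] contains [v], so [A] lies in the star of [v]; both have
    cardinality [d], hence they are equal. *)
Lemma coincident_star (d : nat) (A : {set {set V}}) (v : V) :
  A \subset edges H -> #|A| = d -> v \in coincident H d A ->
  A = [set e in edges H | v \in e].
Proof.
move=> sAE cardA; rewrite inE => /andP[/eqP deg_v /forall_inP v_in].
apply/eqP; rewrite eqEcard cardA -[X in _ <= X]deg_v leqnn andbT.
by apply/subsetP=> e Ae; rewrite inE (subsetP sAE) ?v_in.
Qed.

Lemma coincident_partE (S : {set V}) (d : nat) (A : {set {set V}}) :
  coincident_part H S d A = S :&: coincident H d A.
Proof. by rewrite /coincident_part; case: eqP => // ->; rewrite setI0. Qed.

End CoincidentSets.

Theorem theorem2p6 (V : finType) (H : hypergraph V)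
  (Hconn : connected_hypergraph H) (Hsperner : sperner H)
  (Hm : 2 <= #|edges H|)
  (F : forall d : nat, 'I_('C(#|edges H|, d)) -> {set {set V}})
  (HF : enumerates_edge_subsets F)
  (S : {set V}) (HS : minimum_locating_dominating H S) :
  let Cpart (d : nat) (i : 'I_('C(#|edges H|, d))) : {set V} :=
    coincident_part H S d (F d i) in
  let C : {set V} :=
    \bigcup_(1 <= d < (max_degree H).+1)
      \bigcup_(i < 'C(#|edges H|, d)) Cpart d i in
  #|C| <= #|S| /\
  #|C| = \sum_(1 <= d < (max_degree H).+1)
           \sum_(i < 'C(#|edges H|, d)) #|Cpart d i|.
Proof.
move=> Cpart C.
have CpartP d i v : v \in Cpart d i -> v \in S /\ v \in coincident H d (F d i).
  by rewrite /Cpart coincident_partE => /setIP.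
split.
  apply/subset_leq_card/subsetP=> v.
  by move=> /mem_bigcup_seq[d _ /bigcupP[i _ /CpartP[]]].
rewrite /C card_bigcup_disjoint ?iota_uniq // => [|d d' _ _ v]; last first.
  have deg_v c :
      v \in \bigcup_(i < 'C(#|edges H|, c)) Cpart c i -> degree H v = c.
    by case/bigcupP=> i _ /CpartP[_]; rewrite inE => /andP[/eqP].
  by move=> /deg_v <- /deg_v.
apply: eq_bigr => d _.
apply: card_bigcup_disjoint => [|i j _ _ v]; first exact: index_enum_uniq.
move=> /CpartP[_ v_i] /CpartP[_ v_j].
have [F_inj F_subsets] := HF d.
have F_star k : v \in coincident H d (F d k) ->
    F d k = [set e in edges H | v \in e].
  have /F_subsets/andP[sFE /eqP cardF] : exists l, F d l = F d k by exists k.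
  exact: coincident_star.
by apply: F_inj; rewrite (F_star i v_i) (F_star j v_j).
Qed.
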